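(* Let $(X^s_*(\cdot),U^s_*(\cdot))$ be the optimal stationary pair and let $S\in\mathbb{R}^{n\times n}$, $H\in\mathbb{R}^{(n+l)\times(n+l)}$ be symmetric positive definite matrices satisfying the dissipativity identity (both as described in the context). Then for each $X_0\sim\mathcal{N}(\mu_0,\Sigma_0)$ there exists a constant $C\in\mathbb{R}$ such that for each $\delta>0$, each $N\in\mathbb{N}$, each control process $U(\cdot)$ satisfying $$J_N(X_0,U)\le \delta+\sum_{k=0}^{N-1}\ell(X^s_*(k),U^s_*(k)),$$ and each $\epsilon,\eta>0$, the value $$P_{\epsilon,\eta}:=\#\Big\{k\in\{0,\ldots,N-1\}\;\Big|\;\mathbb{P}\Big(\big\|(X(k)-X^s_*(k),\,U(k)-U^s_*(k))\big\|_H^2\ge\epsilon\Big)\le\eta\Big\},$$ where $X(\cdot)=X_U(\cdot,X_0)$, satisfies $$P_{\epsilon,\eta}\ge N-\frac{\delta+C}{\epsilon\,\eta}.$$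
   Context: Setting. Let $A\in\mathbb{R}^{n\times n}$, $B\in\mathbb{R}^{n\times l}$ with $(A,B)$ stabilizable; $R\in\mathbb{R}^{l\times l}$ symmetric positive definite; $Q\in\mathbb{R}^{n\times n}$ symmetric positive semidefinite with $(A,Q^{1/2})$ detectable. On a probability space $(\Omega,\mathcal{F},\mathbb{P})$ consider $$X(k+1)=AX(k)+BU(k)+W(k),\quad X(0)=X_0,\qquad k\in\mathbb{N}_0,$$ where $W(k)\sim\mathcal{N}(0,\Sigma_W)$ are i.i.d. $\mathbb{R}^n$-valued Gaussian random variables with zero mean and covariance $\Sigma_W$, and $X_0\sim\mathcal{N}(\mu_0,\Sigma_0)$. A control process is a sequence $U(\cdot)$ with $U(k)\in L^2(\Omega,\mathcal{F}_k,\mathbb{P},\mathbb{R}^l)$, where $\mathcal{F}_k=\sigma(X(0),\ldots,X(k))$ is the filtration generated by the corresponding state process; also $X(k)\in L^2(\Omega,\mathcal{F}_k,\mathbb{P},\mathbb{R}^n)$. It is a standing assumption that for every state and control process under consideration $W(k)$ is independent of $(X(k),U(k))$ for all $k$ (this also applies to the stationary pair $(X^s_*(\cdot),U^s_*(\cdot))$). The solution is denoted $X_U(\cdot,X_0)$, or $X(\cdot)$ for short. Notation: $\|x\|_M^2:=x^TMx$ for a symmetric positive semidefinite matrix $M$; $(x,u)$ is the stacked vector in $\mathbb{R}^{n+l}$. Stage cost: $\ell(X,U):=\mathbb{E}[\|X\|_Q^2+\|U\|_R^2]$. Cost: $J_N(X_0,U):=\sum_{k=0}^{N-1}\ell(X(k),U(k))$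 with $X(\cdot)=X_U(\cdot,X_0)$. Let $P$ be the unique positive semidefinite solution of $P=A^TPA+Q-A^TPB[R+B^TPB]^{-1}B^TPA$ and $K:=-[R+B^TPB]^{-1}B^TPA$ (so $A+BK$ is Schur-stable). Optimal stationary pair: $U^s_*(k)=KX^s_*(k)$, $X^s_*(k+1)=(A+BK)X^s_*(k)+W(k)$ (with the same noise process $W(\cdot)$ that drives the system $X(k+1)=AX(k)+BU(k)+W(k)$), $X^s_*(0)\sim\mathcal{N}(0,\Sigma^s_* )$, where $\Sigma^s_*$ is the solution of $\Sigma^s_*=(A+BK)\Sigma^s_*(A+BK)^T+\Sigma_W$; thus $X^s_*(k)\sim\mathcal{N}(0,\Sigma^s_* )$ for all $k$. Dissipativity identity: the symmetric positive definite matrices $S$ and $H$ are such that for every control process $U(\cdot)$ with state $X(\cdot)$ and every $k\in\mathbb{N}_0$, $$\ell(X(k),U(k))-\ell(X^s_*(k),U^s_*(k))+\tilde\lambda(k,X(k))-\tilde\lambda(k+1,X(k+1))=\mathbb{E}\big[\|(X(k)-X^s_*(k),U(k)-U^s_*(k))\|_H^2\big],$$ where $\tilde\lambda(k,X(k)):=-\mathbb{E}\big[\|X(k)\|_P^2-\|X(k)-X^s_*(k)\|_P^2\big]+\mathbb{E}\big[\|X(k)-X^s_*(k)\|_S^2\big]$. Such matrices exist. *)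

(* Defs.v *)
From HB Require Import structures.
From mathcomp Require Import all_boot all_order all_algebra.
From mathcomp Require Import complex.
From mathcomp Require Import all_classical all_reals all_analysis.

Set Implicit Arguments.
Unset Strict Implicit.
Unset Printing Implicit Defensive.

Import Order.TTheory GRing.Theory Num.Theory.
Import numFieldNormedType.Exports.

Local Open Scope classical_set_scope.
Local Open Scope ring_scope.

(* Borel sigma-algebra on matrices, so that {RV P >-> 'cV[R]_n} is the type of
   R^n-valued random variables. *)
HB.instance Definition _ (R : realType) (m n : nat) :=
  Measurable.copy 'M[R]_(m, n) (g_sigma_algebraType (@open 'M[R]_(m, n))).

Section LinearAlgebra.
Variable R : realType.

(* ||x||_M^2 *)
Definition sqnorm (n : nat) (M : 'M[R]_n) (x : 'cV[R]_n) : R :=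
  (x^T *m M *m x) 0 0.

Definition sym_psd (n : nat) (M : 'M[R]_n) : Prop :=
  M^T = M /\ forall x : 'cV[R]_n, 0 <= sqnorm M x.

Definition sym_pd (n : nat) (M : 'M[R]_n) : Prop :=
  M^T = M /\ forall x : 'cV[R]_n, x != 0 -> 0 < sqnorm M x.

Definition schur_stable (n : nat) (M : 'M[R]_n) : Prop :=
  forall z : R[i], eigenvalue (map_mx (real_complex R) M) z -> `|z| < 1.

Definition stabilizable (n l : nat) (A : 'M[R]_n) (B : 'M[R]_(n, l)) : Prop :=
  exists F : 'M[R]_(l, n), schur_stable (A + B *m F).

Definition detectable (n p : nat) (A : 'M[R]_n) (C : 'M[R]_(p, n)) : Prop :=
  exists L : 'M[R]_(n, p), schur_stable (A + L *m C).

Definition is_psd_sqrt (n : nat) (M Mh : 'M[R]_n) : Prop :=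
  sym_psd Mh /\ Mh *m Mh = M.

Definition riccati (n l : nat) (A : 'M[R]_n) (B : 'M[R]_(n, l))
    (Q : 'M[R]_n) (Rm : 'M[R]_l) (Pm : 'M[R]_n) : Prop :=
  Pm = A^T *m Pm *m A + Q
       - A^T *m Pm *m B *m invmx (Rm + B^T *m Pm *m B) *m B^T *m Pm *m A.

Definition feedback_gain (n l : nat) (A : 'M[R]_n) (B : 'M[R]_(n, l))
    (Rm : 'M[R]_l) (Pm : 'M[R]_n) : 'M[R]_(l, n) :=
  - (invmx (Rm + B^T *m Pm *m B) *m B^T *m Pm *m A).

End LinearAlgebra.

Section Probability.
Context (d : measure_display) (Omega : measurableType d) (R : realType)
  (P : probability Omega R).

(* The univariate law N(m, v), parameterized by the variance; for v = 0 it is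
   the Dirac mass at m, whereas [normal_prob m 0] is uniform on [0, 1]. *)
Definition normal_law (m v : R) (B : set R) : \bar R :=
  if v == 0 then \d_m B else normal_prob m (Num.sqrt v) B.

(* X ~ N(mu, Sigma), possibly degenerate: every linear combination t^T X of the
   components has law N(t^T mu, t^T Sigma t). *)
Definition gaussian (n : nat) (X : {RV P >-> 'cV[R]_n}) (mu : 'cV[R]_n)
    (Sigma : 'M[R]_n) : Prop :=
  sym_psd Sigma /\
  forall (t : 'cV[R]_n) (B : set R), measurable B ->
    P [set w | B ((t^T *m X w) 0 0)]
      = normal_law ((t^T *m mu) 0 0) (sqnorm Sigma t) B.

Definition independent (d1 d2 : measure_display) (T1 : measurableType d1)
    (T2 : measurableType d2) (X : Omega -> T1) (Y : Omega -> T2) : Prop :=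
  forall (B1 : set T1) (B2 : set T2), measurable B1 -> measurable B2 ->
    P ((X @^-1` B1) `&` (Y @^-1` B2)) = (P (X @^-1` B1) * P (Y @^-1` B2))%E.

Definition mutually_independent (d1 : measure_display)
    (T1 : measurableType d1) (X : nat -> Omega -> T1) : Prop :=
  forall (J : seq nat) (B : nat -> set T1), uniq J ->
    (forall k, measurable (B k)) ->
    P (\bigcap_(k in [set` J]) (X k @^-1` B k))
      = (\prod_(k <- J) P (X k @^-1` B k))%E.

(* W(0), W(1), ... i.i.d. with common law N(0, SigmaW) *)
Definition iid_gaussian_noise (n : nat) (W : nat -> {RV P >-> 'cV[R]_n})
    (SigmaW : 'M[R]_n) : Prop :=
  mutually_independent (fun k => W k : Omega -> 'cV[R]_n) /\
  forall k, gaussian (W k) 0 SigmaW.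

(* sigma(X(0), ..., X(k)) *)
Definition natural_filtration (n : nat) (X : nat -> Omega -> 'cV[R]_n)
    (k : nat) : set (set Omega) :=
  <<s \bigcup_(i in [set i | (i <= k)%N])
        preimage_set_system setT (X i) measurable >>.

(* Y \in L^2(Omega, F, P, R^m) *)
Definition inL2 (m : nat) (F : set (set Omega)) (Y : Omega -> 'cV[R]_m) : Prop :=
  (forall B : set 'cV[R]_m, measurable B -> F (Y @^-1` B)) /\
  (forall i : 'I_m, (fun w => Y w i 0) \in Lfun P 2%:E).

End Probability.

Section Control.
Context (d : measure_display) (Omega : measurableType d) (R : realType)
  (P : probability Omega R) (n l : nat).

(* X_U(., X0) *)
Fixpoint state (A : 'M[R]_n) (B : 'M[R]_(n, l))
    (W : nat -> {RV P >-> 'cV[R]_n}) (X0 : {RV P >-> 'cV[R]_n})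
    (U : nat -> {RV P >-> 'cV[R]_l}) (k : nat) : Omega -> 'cV[R]_n :=
  if k is k'.+1
  then fun w => A *m state A B W X0 U k' w + B *m U k' w + W k' w
  else X0.

Definition control_process (A : 'M[R]_n) (B : 'M[R]_(n, l))
    (W : nat -> {RV P >-> 'cV[R]_n}) (X0 : {RV P >-> 'cV[R]_n})
    (U : nat -> {RV P >-> 'cV[R]_l}) : Prop :=
  let X := state A B W X0 U in
  forall k : nat,
    [/\ inL2 P (natural_filtration X k) (X k),
        inL2 P (natural_filtration X k) (U k)
      & independent P (W k) (fun w => col_mx (X k w) (U k w))].

Definition stage_cost (Q : 'M[R]_n) (Rm : 'M[R]_l)
    (X : Omega -> 'cV[R]_n) (U : Omega -> 'cV[R]_l) : \bar R :=
  ('E_P[(fun w => sqnorm Q (X w) + sqnorm Rm (U w))%R])%E.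

Definition cost (A : 'M[R]_n) (B : 'M[R]_(n, l)) (Q : 'M[R]_n) (Rm : 'M[R]_l)
    (W : nat -> {RV P >-> 'cV[R]_n}) (N : nat) (X0 : {RV P >-> 'cV[R]_n})
    (U : nat -> {RV P >-> 'cV[R]_l}) : \bar R :=
  (\sum_(0 <= k < N) stage_cost Q Rm (state A B W X0 U k) (U k))%E.

Record optimal_stationary_pair (A : 'M[R]_n) (B : 'M[R]_(n, l))
    (K : 'M[R]_(l, n)) (SigmaW : 'M[R]_n) (W : nat -> {RV P >-> 'cV[R]_n})
    (Xs : nat -> {RV P >-> 'cV[R]_n}) (Us : nat -> {RV P >-> 'cV[R]_l})
    (Sigmas : 'M[R]_n) : Prop := {
  stationary_feedback : forall k w, Us k w = K *m Xs k w;
  stationary_dynamics :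
    forall k w, Xs k.+1 w = (A + B *m K) *m Xs k w + W k w;
  stationary_covariance :
    Sigmas = (A + B *m K) *m Sigmas *m (A + B *m K)^T + SigmaW;
  stationary_law : gaussian (Xs 0%N) 0 Sigmas;
  stationary_indep :
    forall k, independent P (W k) (fun w => col_mx (Xs k w) (Us k w)) }.

Definition deviation (X Xs : Omega -> 'cV[R]_n) (U Us : Omega -> 'cV[R]_l)
    (w : Omega) : 'cV[R]_(n + l) :=
  col_mx (X w - Xs w) (U w - Us w).

(* lambda~(k, X(k)), with X and Xs standing for X(k) and X^s_*(k) *)
Definition storage (Pm S : 'M[R]_n) (X Xs : Omega -> 'cV[R]_n) : \bar R :=
  (- 'E_P[(fun w => sqnorm Pm (X w) - sqnorm Pm (X w - Xs w))%R]
   + 'E_P[(fun w => sqnorm S (X w - Xs w))%R])%E.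

(* The initial values range over all Gaussian random vectors. *)
Definition dissipativity (A : 'M[R]_n) (B : 'M[R]_(n, l))
    (Q : 'M[R]_n) (Rm : 'M[R]_l) (Pm : 'M[R]_n)
    (W : nat -> {RV P >-> 'cV[R]_n})
    (Xs : nat -> {RV P >-> 'cV[R]_n}) (Us : nat -> {RV P >-> 'cV[R]_l})
    (S : 'M[R]_n) (H : 'M[R]_(n + l)) : Prop :=
  forall (mu0 : 'cV[R]_n) (Sigma0 : 'M[R]_n) (X0 : {RV P >-> 'cV[R]_n}),
  gaussian X0 mu0 Sigma0 ->
  forall U : nat -> {RV P >-> 'cV[R]_l}, control_process A B W X0 U ->
  let X := state A B W X0 U in
  forall k : nat,
    (stage_cost Q Rm (X k) (U k) - stage_cost Q Rm (Xs k) (Us k)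
      + storage Pm S (X k) (Xs k) - storage Pm S (X k.+1) (Xs k.+1)
     = 'E_P[(fun w => sqnorm H (deviation (X k) (Xs k) (U k) (Us k) w))])%E.

End Control.

(* Main.v *)
Require Import Defs.
From mathcomp Require Import all_boot all_order all_algebra.
From mathcomp Require Import all_classical all_reals all_analysis.
From mathcomp Require Import measurable_realfun ring lra.

Import Order.TTheory GRing.Theory Num.Theory.
Import numFieldNormedType.Exports.

Local Open Scope classical_set_scope.
Local Open Scope ring_scope.

(** Summing the dissipativity identity telescopes to
      [\sum_k E |dev k|_H^2 <= delta + lambda(0, X0) - lambda(N, X(N))],
    and Markov's inequality turns this into a bound on the number of bad [k].
    It remains to bound [lambda(N, X(N))] from below uniformly in [N] and [U].
    Completing the square in the [S]-norm gives
    [lambda(k, X) >= - c E |Xs k|_P^2], and the dissipativity identity applied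
    to the stationary pair itself shows that [E |Xs k|_P^2] does not depend on
    [k]; neither the stability of [A + BK] nor the law of [Xs k] for [k > 0] is
    involved. *)

(** * Quadratic forms and a pointwise lower bound for the storage integrand *)

Section QuadraticForms.
Context {R : realType} {n : nat}.
Implicit Types (M S : 'M[R]_n) (x y : 'cV[R]_n).

Lemma sqnormE M x :
  sqnorm M x = \sum_j \sum_i x i 0 * M i j * x j 0.
Proof.
rewrite /sqnorm mxE; apply: eq_bigr => j _; rewrite mxE mulr_suml.
by apply: eq_bigr => i _; rewrite mxE.
Qed.

Lemma sqnorm0 M : sqnorm M 0 = 0.
Proof. by rewrite /sqnorm mulmx0 mxE. Qed.

Lemma sqnormZ M a x : sqnorm M (a *: x) = a ^+ 2 * sqnorm M x.
Proof.
rewrite /sqnorm [(a *: x)^T]linearZ/= -!scalemxAl -scalemxAr !mxE.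
by rewrite expr2 mulrA.
Qed.

Lemma sqnormB M x y : M^T = M ->
  sqnorm M (x - y) = sqnorm M x - ((x^T *m (M *m y)) 0 0) *+ 2 + sqnorm M y.
Proof.
move=> symM.
have yx : (y^T *m M *m x) 0 0 = (x^T *m (M *m y)) 0 0.
  transitivity ((x^T *m (M *m y))^T 0 0); last by rewrite mxE.
  by rewrite !trmx_mul trmxK symM.
rewrite /sqnorm [(x - y)^T]linearB/= !mulmxBl !mulmxBr.
have e (a b c e : 'M[R]_1) :
    (a - b - (c - e)) 0 0 = a 0 0 - b 0 0 - (c 0 0 - e 0 0) by rewrite !mxE.
rewrite e yx mulmxA; ring.
Qed.

(* Nonnegativity of [M] at [t e_i - x] with [t = (M x)_i / (1 + M i i)]. *)
Lemma sqr_mulmx_le M x i : sym_psd M ->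
  (M *m x) i 0 ^+ 2 <= (1 + M i i) * sqnorm M x.
Proof.
move=> [symM M_ge0]; set q := sqnorm M x; set b := (M *m x) i 0.
have qe : sqnorm M (delta_mx i 0) = M i i.
  by rewrite /sqnorm trmx_delta -rowE -colE !mxE.
have Mii : 0 <= M i i by rewrite -qe.
pose t := b / (1 + M i i).
have /= := M_ge0 (t *: delta_mx i 0 - x).
rewrite sqnormB// -/q.
rewrite sqnormZ qe (_ : (_ *m _) 0 0 = t * b); last first.
  rewrite [(t *: _)^T]linearZ/= -scalemxAl trmx_delta -rowE mxE.
  by rewrite [row _ _ _ _]mxE.
have tE : t * (1 + M i i) = b by rewrite divfK// gt_eqF// ltr_wpDr.
(* Since [b = t (1 + M i i)], [h] amounts to [q >= t^2 (2 + M i i)]; one [t^2] is dropped. The added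
   1 in the denominator of [t] covers [M i i = 0]. *)
rewrite -tE mulr2n => h.
have : 0 <= t ^+ 2 by exact: sqr_ge0.
nra.
Qed.

(** Every coordinate of [M *m x] is controlled by [sqnorm M x], hence so is every product of two
    coordinates. This holds even for singular [M], and is applied to the remainder [invmx S] left by
    completing the square. *)
Lemma sqnorm_mulmx_le M S : sym_psd M ->
  exists2 c, 0 <= c & forall x, sqnorm S (M *m x) <= c * sqnorm M x.
Proof.
move=> psdM; have [symM M_ge0] := psdM.
have Mii i : 0 <= M i i.
  by have := M_ge0 (delta_mx i 0); rewrite /sqnorm trmx_delta -rowE -colE !mxE.
pose D := \sum_i (1 + M i i).
have D_ge i : 1 + M i i <= D.
  rewrite /D (bigD1 i)//= lerDl sumr_ge0// => j _.
  by rewrite addr_ge0.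
exists (\sum_j \sum_i `|S i j| * D).
  apply: sumr_ge0 => j _; apply: sumr_ge0 => i _; rewrite mulr_ge0//.
  by rewrite (le_trans _ (D_ge i))// addr_ge0.
move=> x; rewrite sqnormE mulr_suml; apply: ler_sum => j _.
rewrite mulr_suml; apply: ler_sum => i _.
have yD k : (M *m x) k 0 ^+ 2 <= D * sqnorm M x.
  by apply: le_trans (sqr_mulmx_le _ _ _ psdM) _; rewrite ler_wpM2r.
have := yD i; have := yD j; set u := _ j 0; set v := _ i 0 => hu hv.
rewrite mulrAC [leLHS]mulrC (le_trans (ler_norm _))// normrM -mulrA.
(* The two squares give [2 |u v| <= u^2 + v^2], and [D] bounds both terms. *)
rewrite ler_wpM2l// ler_norml; have := sqr_ge0 (u - v); have := sqr_ge0 (u + v).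
nra.
Qed.

Lemma sym_pd_unitmx S : sym_pd S -> S \in unitmx.
Proof.
move=> [symS S_gt0]; rewrite -row_free_unit -kermx_eq0.
apply/negPn/negP => /rowV0Pn[v /sub_kermxP vS v0].
have := S_gt0 v^T; rewrite /sqnorm trmxK vS mul0mx mxE ltxx.
by rewrite trmx_eq0 => /(_ v0).
Qed.

(* Completing the square in the [S]-norm around [invmx S *m z]. *)
Lemma sym_pd_young S x z : sym_pd S ->
  (x^T *m z) 0 0 *+ 2 <= sqnorm S x + sqnorm (invmx S) z.
Proof.
move=> pdS; have [symS S_gt0] := pdS; have Su := sym_pd_unitmx _ pdS.
have : 0 <= sqnorm S (x - invmx S *m z).
  have [->|/S_gt0/ltW//] := eqVneq (x - invmx S *m z) 0.
  by rewrite sqnorm0.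
rewrite sqnormB// mulKVmx//.
rewrite [sqnorm S (invmx S *m z)](_ : _ = sqnorm (invmx S) z).
  by lra.
by rewrite /sqnorm trmx_mul trmx_inv symS -!mulmxA mulKVmx.
Qed.

(** With [z = x - y], the right-hand side equals [|z|_S^2 - 2 z^T M y - |y|_M^2]. Young's inequality
    absorbs the cross term at the price of the [invmx S]-norm of [M y], which is at most
    [c |y|_M^2]; the last term accounts for the 1 in [c + 1]. *)
Lemma storage_integrand_ge M S : sym_psd M -> sym_pd S ->
  exists2 c, 0 <= c & forall x y,
  - (c * sqnorm M y) <=
    - (sqnorm M x - sqnorm M (x - y)) + sqnorm S (x - y).
Proof.
move=> psdM pdS; have [symM M_ge0] := psdM.
have [c c0 hc] := sqnorm_mulmx_le _ (invmx S) psdM.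
exists (c + 1) => [|x y]; first by rewrite addr_ge0.
have := sym_pd_young _ (x - y) (M *m y) pdS.
have -> : ((x - y)^T *m (M *m y)) 0 0 = (x^T *m (M *m y)) 0 0 - sqnorm M y.
  rewrite [(x - y)^T]linearB/= mulmxBl mxE.
  by congr (_ + _); rewrite [LHS]mxE /sqnorm mulmxA.
rewrite [sqnorm M (x - y)]sqnormB// mulrDl.
have := hc y; lra.
Qed.

End QuadraticForms.

(** * Borel measurability of linear maps and coordinates *)

Lemma continuous_mulmx {R : realType} {m n p : nat} (A : 'M[R]_(m, n)) :
  continuous (fun x : 'M[R]_(n, p) => A *m x).
Proof.
have coord i j : continuous (fun y : 'M[R]_(n, p) => (A *m y) i j).
  under eq_fun do rewrite mxE.
  apply: continuous_big => [|k _ y]; first exact: add_continuous.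
  by apply: continuousM; [exact: cst_continuous|exact: coord_continuous].
(* A neighbourhood contains a box [V] of entrywise neighbourhoods, and finitely many entrywise
   conditions hold simultaneously near [x]. *)
move=> x U [V nV VU].
have : \forall y \near x, forall i j, V i j ((A *m y) i j).
  apply: (@filter_forall _ _ _ _ (nbhs_filter x)) => i.
  apply: (@filter_forall _ _ _ _ (nbhs_filter x)) => j.
  exact: (coord i j x).
by apply: filterS => y Vy; exact: VU.
Qed.

Lemma continuous_measurable_mx {R : realType} {m n p q : nat}
    (f : 'M[R]_(m, n) -> 'M[R]_(p, q)) :
  continuous f -> measurable_fun setT f.
Proof.
move=> /continuousP cf; apply: (@measurability _ _ _ _ setT f (@open _)) => //.
move=> _ [B oB <-]; rewrite setTI; apply: sub_sigma_algebra; exact: cf.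
Qed.

Lemma measurable_coord {R : realType} {m n : nat} (i : 'I_m) (j : 'I_n) :
  measurable_fun setT (fun x : 'M[R]_(m, n) => x i j).
Proof.
apply: (@measurability _ _ _ _ _ _ _ (RGenOpens.measurableE R)).
move=> _ [B [a [b ->]] <-]; rewrite setTI; apply: sub_sigma_algebra.
by have /continuousP := @coord_continuous R m n i j; apply.
Qed.

(** * Membership in L^p and integrals against normal laws *)

Lemma sqr_integral_lty_Lfun2 {d} {T : measurableType d} {R : realType}
    (mu : {measure set T -> \bar R}) (f : T -> R) :
  measurable_fun setT f -> (\int[mu]_x (f x ^+ 2)%:E < +oo)%E ->
  f \in Lfun mu 2%:E.
Proof.
move=> mf f2; rewrite inE; apply/andP; split; first by rewrite inE.
rewrite inE/= /finite_norm unlock /Lnorm poweR_lty//.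
rewrite (_ : (\int[mu]_x _)%E = (\int[mu]_x (f x ^+ 2)%:E)%E)//.
apply: eq_integral => x _.
by rewrite /= powR_mulrn// -normrX ger0_norm// sqr_ge0.
Qed.

Section LfunClosure.
Context {d} {T : measurableType d} {R : realType}
  (mu : {measure set T -> \bar R}).

Lemma LfunD (p : \bar R) (f g : T -> R) : (1 <= p)%E ->
  f \in Lfun mu p -> g \in Lfun mu p -> f \+ g \in Lfun mu p.
Proof. by move=> p1; exact: (Lfun_addr_closed mu p1).2. Qed.

Lemma LfunB (p : \bar R) (f g : T -> R) : (1 <= p)%E ->
  f \in Lfun mu p -> g \in Lfun mu p -> f \- g \in Lfun mu p.
Proof.
move=> p1 fp gp.
have -> : f \- g = f \+ (\- g) by [].
by apply: LfunD => //; exact: Lfun_oppr_closed.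
Qed.

Lemma Lfun_sum (p : \bar R) (I : Type) (s : seq I) (F : I -> T -> R) :
  (1 <= p)%E -> (forall i, F i \in Lfun mu p) ->
  (fun x => \sum_(i <- s) F i x) \in Lfun mu p.
Proof.
move=> p1 FL; elim: s => [|i s IH].
  under eq_fun do rewrite big_nil.
  exact: (Lfun_addr_closed mu p1).1.
by under eq_fun do rewrite big_cons; exact: LfunD.
Qed.

End LfunClosure.

(** The change of variables holds for the Radon-Nikodym derivative, which agrees almost everywhere
    with [normal_pdf] because both have the same integral over each measurable set. *)
Lemma ge0_integral_normal_prob {R : realType} (m s : R) (f : R -> \bar R) :
  measurable_fun setT f -> (forall x, 0 <= f x)%E ->
  (\int[normal_prob m s]_x f x
   = \int[lebesgue_measure]_x (f x * (normal_pdf m s x)%:E))%E.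
Proof.
move=> mf f0; pose nu : {finite_measure set _ -> \bar R} := normal_prob m s.
have dom : nu `<< (@lebesgue_measure R) := normal_prob_dominates m s.
pose g := Radon_Nikodym_SigmaFinite.f nu (@lebesgue_measure R).
have g_int := Radon_Nikodym_SigmaFinite.f_integrable dom.
have mg : measurable_fun setT g := measurable_int _ g_int.
have mpdf : measurable_fun setT (EFin \o normal_pdf m s).
  by apply/measurable_EFinP; exact: measurable_normal_pdf.
rewrite -(Radon_Nikodym_SigmaFinite.change_of_variables dom)//.
apply: ge0_ae_eq_integral => //.
- exact: emeasurable_funM.
- exact: emeasurable_funM.
- by move=> x _; rewrite mule_ge0// Radon_Nikodym_SigmaFinite.f_ge0.
- by move=> x _; rewrite mule_ge0// lee_fin normal_pdf_ge0.
apply: ae_eqe_mul2l; apply: integral_ae_eq => // E _ mE.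
by rewrite -Radon_Nikodym_SigmaFinite.f_integral.
Qed.

(* With [u = (x - m)^2 / (4 s^2)], the bound [u e^(-2u) <= e^(-u)] dominates
   [(x - m)^2] times the density of N(m, s) by a multiple of the density of
   N(m, sqrt 2 s). *)
Lemma normal_prob_centered_sqr_lty {R : realType} (m s : R) : s != 0 ->
  (\int[normal_prob m s]_x ((x - m) ^+ 2)%:E < +oo)%E.
Proof.
move=> s0; pose s' := Num.sqrt 2 * s.
have s2 : 0 < s ^+ 2 by rewrite exprn_even_gt0.
have s'2 : s' ^+ 2 = 2 * s ^+ 2 by rewrite exprMn sqr_sqrtr.
have s'0 : s' != 0 by rewrite mulf_neq0// gt_eqF.
have p0 := normal_peak_gt0 s0; have p'0 := normal_peak_gt0 s'0.
(* [c] turns the peak of the wider density into [4 s^2] times the peak of the original one. *)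
pose c := 4 * s ^+ 2 * normal_peak s / normal_peak s'.
rewrite ge0_integral_normal_prob//; last 2 first.
- by apply/measurable_EFinP; apply: measurable_funX; exact: measurable_funB.
- by move=> x; rewrite lee_fin sqr_ge0.
apply: (@le_lt_trans _ _
  (\int[lebesgue_measure]_x (c%:E * (normal_pdf m s' x)%:E))%E); last first.
  rewrite integralZl//; last exact: integrable_normal_pdf.
  by rewrite integral_normal_pdf mule1 ltry.
apply: ge0_le_integral => //.
- by move=> x _; rewrite mule_ge0// lee_fin ?sqr_ge0 ?normal_pdf_ge0.
- apply: emeasurable_funM; apply/measurable_EFinP.
    by apply: measurable_funX; exact: measurable_funB.
  exact: measurable_normal_pdf.
- apply: emeasurable_funM; apply/measurable_EFinP => //.
  exact: measurable_normal_pdf.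
move=> x _; rewrite -!EFinM lee_fin !normal_pdfE// /normal_fun.
set u := (x - m) ^+ 2 / (4 * s ^+ 2).
have -> : - (x - m) ^+ 2 / (s ^+ 2 *+ 2) = - u - u by rewrite /u; field.
have -> : - (x - m) ^+ 2 / (s' ^+ 2 *+ 2) = - u by rewrite s'2 /u; field.
have -> : (x - m) ^+ 2 = 4 * s ^+ 2 * u by rewrite /u; field.
have u_le : u * expR (- u) <= 1.
  rewrite expRN ler_pdivrMr ?expR_gt0// mul1r.
  by rewrite (le_trans _ (expR_ge1Dx u))// lerDr.
rewrite expRD.
have -> : c * (normal_peak s' * expR (- u)) =
    4 * s ^+ 2 * normal_peak s * expR (- u) by rewrite /c; field; rewrite gt_eqF.
have -> : 4 * s ^+ 2 * u * (normal_peak s * (expR (- u) * expR (- u))) =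
   4 * s ^+ 2 * normal_peak s * expR (- u) * (u * expR (- u)) by ring.
by rewrite ler_piMr// mulr_ge0 ?expR_ge0// mulr_ge0 ?(ltW p0)// mulr_ge0// ltW.
Qed.

(** * Square-integrable random vectors; Gaussian vectors are among them *)

Section SquareIntegrableVectors.
Context {d : measure_display} {Omega : measurableType d} {R : realType}
  (P : probability Omega R).

(** The integrability half of [inL2], separated from adaptedness. *)
Definition L2vec {m : nat} (Y : Omega -> 'cV[R]_m) :=
  forall i, (fun w => Y w i 0) \in Lfun P 2%:E.

Lemma L2vecD {m : nat} (X Y : Omega -> 'cV[R]_m) :
  L2vec X -> L2vec Y -> L2vec (fun w => X w + Y w).
Proof.
move=> LX LY i; under eq_fun do rewrite mxE.
by apply: LfunD => //; exact: lee1n.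
Qed.

Lemma L2vecB {m : nat} (X Y : Omega -> 'cV[R]_m) :
  L2vec X -> L2vec Y -> L2vec (fun w => X w - Y w).
Proof.
move=> LX LY i.
rewrite (_ : (fun _ => _) = (fun w => X w i 0) \- (fun w => Y w i 0)).
  by apply: LfunB => //; exact: lee1n.
by apply/funext => w; rewrite mxE [X in _ + X]mxE.
Qed.

Lemma L2vec_mulmx {m p : nat} (A : 'M[R]_(p, m)) (Y : Omega -> 'cV[R]_m) :
  L2vec Y -> L2vec (fun w => A *m Y w).
Proof.
move=> LY i; under eq_fun do rewrite mxE.
apply: Lfun_sum => [|j]; first exact: lee1n.
under eq_fun do rewrite mulrC.
by apply: Lfun_scale => //; rewrite ler1n.
Qed.

Lemma L2vec_col_mx {m p : nat} (X : Omega -> 'cV[R]_m) (Y : Omega -> 'cV[R]_p) :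
  L2vec X -> L2vec Y -> L2vec (fun w => col_mx (X w) (Y w)).
Proof.
move=> LX LY i; under eq_fun do rewrite mxE.
by case: (fintype.split i) => j /=; [exact: LX|exact: LY].
Qed.

(** The form is a finite combination of products of two L^2 coordinates, each product being in
    L^1. *)
Lemma sqnorm_Lfun1 {m : nat} (M : 'M[R]_m) (Y : Omega -> 'cV[R]_m) :
  L2vec Y -> (fun w => sqnorm M (Y w)) \in Lfun P 1.
Proof.
move=> LY; under eq_fun do rewrite sqnormE.
apply: Lfun_sum => // j; apply: Lfun_sum => // i.
rewrite (_ : (fun _ => _) = M i j \o* (fun w => Y w i 0 * Y w j 0)).
  by apply: Lfun_scale => //; exact: Lfun2_mul_Lfun1.
by apply/funext => w /=; ring.
Qed.

(** The integral of [(Z - m)^2] is transported to the law of [Z]: it vanishes for the Dirac mass and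
    is a finite Gaussian moment otherwise. *)
Lemma normal_law_Lfun2 (Z : Omega -> R) (m v : R) :
  measurable_fun setT Z -> 0 <= v ->
  (forall B, measurable B -> P [set w | B (Z w)] = normal_law m v B) ->
  Z \in Lfun P 2%:E.
Proof.
move=> mZ v0 lawZ.
(* The library's normal law lives on [measurableTypeR R], whose display differs
   from that of [R]. *)
pose Z' : Omega -> measurableTypeR R := Z.
have mZ' : measurable_fun setT Z' by exact: mZ.
have mg : measurable_fun setT (fun x : measurableTypeR R => ((x - m) ^+ 2)%:E).
  by apply/measurable_EFinP; apply: measurable_funX; exact: measurable_funB.
have g0 x : (0 <= ((x - m) ^+ 2)%:E)%E by rewrite lee_fin sqr_ge0.
suff : (Z \- cst m) \in Lfun P 2%:E.
  move=> Zm; have -> : Z = (Z \- cst m) \+ cst m.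
    by apply/funext => w /=; rewrite subrK.
  by apply: LfunD; [exact: lee1n|exact: Zm|exact: Lfun_cst].
apply: sqr_integral_lty_Lfun2; first exact: measurable_funB.
rewrite [ltLHS](_ : _ =
    \int[pushforward P Z']_x ((x - m) ^+ 2)%:E)%E; last first.
  by rewrite ge0_integral_pushforward.
have [v_eq0|v_neq0] := eqVneq v 0.
  rewrite (eq_measure_integral \d_(m : measurableTypeR R)); last first.
    by move=> B mB _; rewrite [LHS]lawZ// /normal_law v_eq0 eqxx.
  by rewrite integral_dirac// subrr expr0n mule0 ltry.
rewrite [ltLHS](_ : _ =
    \int[normal_prob m (Num.sqrt v)]_x ((x - m) ^+ 2)%:E)%E; last first.
  apply: eq_measure_integral => B mB _.
  by rewrite [LHS]lawZ// /normal_law (negbTE v_neq0).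
by apply: normal_prob_centered_sqr_lty; rewrite gt_eqF// sqrtr_gt0 lt_def v_neq0.
Qed.

(** Testing [gaussian] against a basis vector gives the normal law of a coordinate. *)
Lemma gaussian_L2vec {n : nat} (X : {RV P >-> 'cV[R]_n}) mu Sigma :
  gaussian X mu Sigma -> L2vec X.
Proof.
move=> [[_ Sigma0] lawX] i; pose e : 'cV[R]_n := delta_mx i 0.
apply: (@normal_law_Lfun2 _ ((e^T *m mu) 0 0) _ _ (Sigma0 e)).
  exact: measurableT_comp (measurable_coord i 0) _.
move=> B mB; rewrite -lawX//; congr (P _); apply/funext => w /=.
by rewrite trmx_delta -rowE mxE.
Qed.

End SquareIntegrableVectors.

(** * Counting bad indices, and Markov's inequality *)

Lemma card_ge_of_sum_le {R : realFieldType} {I : finType} (good : pred I)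
    (e : I -> R) (t D : R) :
  0 < t -> (forall i, 0 <= e i) -> (forall i, ~~ good i -> t <= e i) ->
  \sum_i e i <= D -> #|I|%:R - D / t <= #|good|%:R.
Proof.
move=> t0 e0 bad_e sumD.
rewrite -(cardC good) natrD lerBlDr lerD2l ler_pdivlMr//.
(* Each bad index contributes at least [t] to the sum, and each good one at least 0. *)
apply: le_trans sumD; rewrite mulr_natl -sumr_const.
rewrite [leRHS](bigID (mem [predC good]))/= -[leLHS]addr0 lerD//.
  by apply: ler_sum => i; exact: bad_e.
exact: sumr_ge0.
Qed.

Section Expectation.
Context {d : measure_display} {Omega : measurableType d} {R : realType}
  {P : probability Omega R}.

Lemma Lfun1_expectation_le (X Y : Omega -> R) :
  X \in Lfun P 1 -> Y \in Lfun P 1 -> (forall w, X w <= Y w) ->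
  ('E_P[X] <= 'E_P[Y])%E.
Proof.
move=> /Lfun1_integrable LX /Lfun1_integrable LY XY.
by rewrite unlock; apply: le_integral => // w _; rewrite lee_fin.
Qed.

Lemma ge0_markov (Z : Omega -> R) (eps : R) :
  measurable_fun setT Z -> (forall w, 0 <= Z w) -> 0 < eps ->
  (eps%:E * P [set w | (eps <= Z w)%R] <= 'E_P[Z])%E.
Proof.
move=> mZ Z0 eps0.
have /measurable_EFinP mZE := mZ.
have := le_integral_abse P measurableT mZE eps0.
rewrite unlock setTI; congr (_ * P _ <= _)%E.
  by apply/funext => w /=; rewrite lee_fin ger0_norm.
by apply: eq_integral => w _ /=; rewrite ger0_norm.
Qed.

End Expectation.

(** * Finiteness and lower bound of the storage *)

Section Storage.
Context {d : measure_display} {Omega : measurableType d} {R : realType}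
  {P : probability Omega R} {n : nat} {Pm S : 'M[R]_n}.
Implicit Types X Y : Omega -> 'cV[R]_n.

Lemma storage_fin_num X Y : L2vec P X -> L2vec P Y ->
  storage P Pm S X Y \is a fin_num.
Proof.
move=> LX LY; have LXY := L2vecB P _ _ LX LY.
rewrite fin_numD fin_numN !expectation_fin_num//; first exact: sqnorm_Lfun1.
by apply: LfunB => //; exact: sqnorm_Lfun1.
Qed.

Lemma storage_diag X : storage P Pm S X X = (- 'E_P[fun w => sqnorm Pm (X w)])%E.
Proof.
rewrite /storage.
under eq_fun do rewrite subrr sqnorm0 subr0.
under [X in (_ + 'E__[X])%E]eq_fun do rewrite subrr sqnorm0.
by rewrite expectation_cst adde0.
Qed.

(** Integrates the pointwise bound. The constant depends on [Pm] and [S] only, so one [c] serves all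
    times and all controls. *)
Lemma storage_ge : sym_psd Pm -> sym_pd S ->
  exists2 c, 0 <= c & forall X Y, L2vec P X -> L2vec P Y ->
    (- (c%:E * 'E_P[fun w => sqnorm Pm (Y w)]) <= storage P Pm S X Y)%E.
Proof.
move=> psdP pdS; have [c c0 hc] := storage_integrand_ge _ _ psdP pdS.
exists c => // X Y LX LY; have LXY := L2vecB P _ _ LX LY.
have LP : (fun w => sqnorm Pm (X w) - sqnorm Pm (X w - Y w)) \in Lfun P 1.
  by apply: LfunB => //; exact: sqnorm_Lfun1.
have LS := sqnorm_Lfun1 P S _ LXY.
have LY1 := sqnorm_Lfun1 P Pm _ LY.
rewrite /storage addeC -expectationB// -mulNe -EFinN -expectationZl//.
apply: Lfun1_expectation_le => [||w].
- by apply: Lfun_scale.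
- exact: LfunB.
- by have := hc (X w) (Y w); rewrite /= mulrN mulrC addrC.
Qed.

End Storage.

(** * The stationary pair as a trajectory of the controlled system *)

Section Stationary.
Context {d : measure_display} {Omega : measurableType d} {R : realType}
  {P : probability Omega R} {n l : nat}.
Context {A : 'M[R]_n} {B : 'M[R]_(n, l)} {K : 'M[R]_(l, n)}
  {SigmaW Sigmas : 'M[R]_n} {W Xs : nat -> {RV P >-> 'cV[R]_n}}
  {Us : nat -> {RV P >-> 'cV[R]_l}}.
Context (W_noise : iid_gaussian_noise W SigmaW)
  (XUs : optimal_stationary_pair A B K SigmaW W Xs Us Sigmas).

Lemma stationary_state k : state A B W (Xs 0%N) Us k = Xs k.
Proof.
elim: k => //= k ->; apply/funext => w.
by rewrite (stationary_dynamics XUs) (stationary_feedback XUs) mulmxDl mulmxA.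
Qed.

Lemma stationary_L2vec k : L2vec P (Xs k).
Proof.
elim: k => [|k IH]; first exact: gaussian_L2vec (stationary_law XUs).
rewrite (_ : (Xs k.+1 : Omega -> _) =
    (fun w => (A + B *m K) *m Xs k w + W k w)); last first.
  by apply/funext => w; rewrite (stationary_dynamics XUs).
apply: L2vecD; first exact: L2vec_mulmx.
exact: gaussian_L2vec (W_noise.2 k).
Qed.

Lemma stationary_feedbackE k : (Us k : Omega -> _) = (fun w => K *m Xs k w).
Proof. by apply/funext => w; rewrite (stationary_feedback XUs). Qed.

Lemma stationary_control_L2vec k : L2vec P (Us k).
Proof. by rewrite stationary_feedbackE; exact/L2vec_mulmx/stationary_L2vec. Qed.

(** Makes the dissipativity identity applicable to the stationary pair. Adaptedness of [Us k]
    follows from that of [Xs k], as the feedback is linear and hence Borel. *)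
Lemma stationary_control_process : control_process A B W (Xs 0%N) Us.
Proof.
have adapted k C : measurable C ->
    natural_filtration (state A B W (Xs 0%N) Us) k (Xs k @^-1` C).
  move=> mC; apply: sub_sigma_algebra; exists k => //=.
  by exists C => //; rewrite setTI stationary_state.
move=> k; split.
- by split; rewrite stationary_state; [exact: adapted|exact: stationary_L2vec].
- split; last exact: stationary_control_L2vec.
  move=> C mC; rewrite stationary_feedbackE.
  have := continuous_measurable_mx _ (@continuous_mulmx R l n 1 K).
  by move=> /(_ measurableT C mC); rewrite setTI => /adapted.
- by rewrite stationary_state; exact: stationary_indep XUs k.
Qed.

(* Apply the dissipativity identity to the stationary pair itself: the stage
   costs cancel, the right-hand side vanishes and the storage is [- E|Xs|_P^2]. *)
Lemma stationary_sqnorm_constant (Q Pm S : 'M[R]_n) (Rm : 'M[R]_l)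
    (H : 'M[R]_(n + l)) k :
  dissipativity A B Q Rm Pm W Xs Us S H ->
  ('E_P[fun w => sqnorm Pm (Xs k w)] = 'E_P[fun w => sqnorm Pm (Xs 0%N w)])%E.
Proof.
move=> diss; elim: k => // k <-.
have := diss _ _ _ (stationary_law XUs) Us stationary_control_process k.
rewrite !stationary_state !storage_diag.
rewrite [X in _ = X -> _](_ : _ = 0%E); last first.
  rewrite (_ : (fun _ => _) = cst 0) ?expectation_cst//.
  by apply/funext => w; rewrite /deviation !subrr col_mx0 sqnorm0.
(* Cancellation in the extended reals requires finite terms. *)
have fin_cost : stage_cost P Q Rm (Xs k) (Us k) \is a fin_num.
  apply: expectation_fin_num; apply: LfunD => //; apply: sqnorm_Lfun1.
    exact: stationary_L2vec.
  exact: stationary_control_L2vec.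
have finP j : ('E_P[fun w => sqnorm Pm (Xs j w)])%E \is a fin_num.
  exact/expectation_fin_num/sqnorm_Lfun1/stationary_L2vec.
rewrite subee// add0e -(fineK (finP k)) -(fineK (finP k.+1)).
by move=> -[]; rewrite opprK addrC => /subr0_eq ->.
Qed.

End Stationary.

Theorem theorem3 (R : realType) (d : measure_display)
  (Omega : measurableType d) (P : probability Omega R) (n l : nat)
  (A : 'M[R]_n) (B : 'M[R]_(n, l)) (Q Qh : 'M[R]_n) (Rm : 'M[R]_l)
  (SigmaW : 'M[R]_n) (W : nat -> {RV P >-> 'cV[R]_n})
  (Pm : 'M[R]_n) (Sigmas : 'M[R]_n)
  (Xs : nat -> {RV P >-> 'cV[R]_n}) (Us : nat -> {RV P >-> 'cV[R]_l})
  (S : 'M[R]_n) (H : 'M[R]_(n + l))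
  (stabAB : stabilizable A B)
  (Rm_pd : sym_pd Rm)
  (Q_psd : sym_psd Q)
  (Qh_sqrt : is_psd_sqrt Q Qh)
  (detAQ : detectable A Qh)
  (W_noise : iid_gaussian_noise W SigmaW)
  (Pm_psd : sym_psd Pm)
  (Pm_riccati : riccati A B Q Rm Pm)
  (XUs_opt : optimal_stationary_pair A B (feedback_gain A B Rm Pm) SigmaW W
               Xs Us Sigmas)
  (S_pd : sym_pd S)
  (H_pd : sym_pd H)
  (SH_diss : dissipativity A B Q Rm Pm W Xs Us S H) :
  forall (mu0 : 'cV[R]_n) (Sigma0 : 'M[R]_n) (X0 : {RV P >-> 'cV[R]_n}),
  gaussian X0 mu0 Sigma0 ->
  exists C : R, forall delta : R, 0 < delta ->
  forall N : nat, (0 < N)%N ->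
  forall U : nat -> {RV P >-> 'cV[R]_l}, control_process A B W X0 U ->
  (cost A B Q Rm W N X0 U
    <= delta%:E + \sum_(0 <= k < N) stage_cost P Q Rm (Xs k) (Us k))%E ->
  forall epsilon eta : R, 0 < epsilon -> 0 < eta ->
  let X := state A B W X0 U in
  let P_eps_eta := #|[pred k : 'I_N |
    (P [set w | (epsilon <= sqnorm H (deviation (X k) (Xs k) (U k) (Us k) w))%R]
      <= eta%:E)%E]| in
  N%:R - (delta + C) / (epsilon * eta) <= P_eps_eta%:R.
Proof.
move=> mu0 Sigma0 X0 gX0.
have [c c0 storage_geP] := @storage_ge _ _ _ P _ _ _ Pm_psd S_pd.
pose p := 'E_P[fun w => sqnorm Pm (Xs 0%N w)]%E.
(* The initial storage plus the uniform bound on minus the final storage; neither involves [delta],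
   [N] or [U]. *)
exists (fine (storage P Pm S X0 (Xs 0%N)) + c * fine p).
move=> delta delta0 N N0 U ctrlU cost_le eps eta eps0 eta0 /=.
set X := state A B W X0 U.
have LXs := stationary_L2vec W_noise XUs_opt.
have LUs := stationary_control_L2vec W_noise XUs_opt.
have LX k : L2vec P (X k) by have [[_ LXk] _ _] := ctrlU k.
have LU k : L2vec P (U k) by have [_ [_ LUk] _] := ctrlU k.
pose Z k w := sqnorm H (deviation (X k) (Xs k) (U k) (Us k) w).
have LZ k : Z k \in Lfun P 1.
  by apply: sqnorm_Lfun1; apply: L2vec_col_mx; exact: L2vecB.
have Z0 k w : 0 <= Z k w.
  have [_ H_gt0] := H_pd; rewrite /Z; move: (deviation _ _ _ _ w) => z.
  by have [->|/H_gt0/ltW//] := eqVneq z 0; rewrite sqnorm0.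
have fin_stage (X' : nat -> Omega -> 'cV[R]_n)
    (U' : nat -> Omega -> 'cV[R]_l) k :
    L2vec P (X' k) -> L2vec P (U' k) ->
    stage_cost P Q Rm (X' k) (U' k) \is a fin_num.
  move=> LX' LU'; apply: expectation_fin_num.
  by apply: LfunD => //; exact: sqnorm_Lfun1.
have sumZ : \sum_(k < N) fine 'E_P[Z k]%E <=
    delta + (fine (storage P Pm S X0 (Xs 0%N)) + c * fine p).
  pose a k := fine (stage_cost P Q Rm (X k) (U k)).
  pose b k := fine (stage_cost P Q Rm (Xs k) (Us k)).
  pose lam k := fine (storage P Pm S (X k) (Xs k)).
  have aE k : stage_cost P Q Rm (X k) (U k) = (a k)%:E.
    by rewrite fineK//; exact: (fin_stage X U).
  have bE k : stage_cost P Q Rm (Xs k) (Us k) = (b k)%:E.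
    by rewrite fineK//; exact: (fin_stage Xs Us).
  have lamE k : storage P Pm S (X k) (Xs k) = (lam k)%:E.
    by rewrite fineK//; exact: storage_fin_num.
  (* All terms being finite, the identity passes to real numbers, where it can be summed. *)
  have diss k : fine 'E_P[Z k]%E = a k - b k + (lam k - lam k.+1).
    have /= := SH_diss _ _ _ gX0 U ctrlU k.
    rewrite -/X aE bE lamE (lamE k.+1) -[X in _ = X]/('E_P[Z k])%E => <-.
    by rewrite /= addrA.
  rewrite (eq_bigr _ (fun (k : 'I_N) _ => diss k)) big_split/=.
  rewrite -(big_mkord xpredT (fun k => a k - b k)).
  rewrite -(big_mkord xpredT (fun k => lam k - lam k.+1)).
  rewrite (telescope_sumr_eq (\- lam) (fun k => lam k - lam k.+1))//; last first.
    by move=> k _; rewrite /= opprK addrC.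
  have : \sum_(0 <= k < N) (a k - b k) <= delta.
    rewrite sumrB lerBlDr -lee_fin EFinD -!sumEFin.
    move: cost_le; rewrite /cost.
    by under eq_bigr do rewrite aE; under [in leRHS]eq_bigr do rewrite bE.
  (* The bound at time [N] involves the stationary state at time [N]; constancy of its [Pm]-moment
     replaces it by [p]. *)
  have : - (c * fine p) <= lam N.
    rewrite -lee_fin -lamE EFinN EFinM fineK; last first.
      exact/expectation_fin_num/sqnorm_Lfun1.
    rewrite /p -(stationary_sqnorm_constant W_noise XUs_opt _ _ _ _ _ N SH_diss).
    exact: storage_geP.
  rewrite -/(lam 0%N) /=; lra.
have := card_ge_of_sum_le
  (fun k : 'I_N => P [set w | (eps <= Z k w)%R] <= eta%:E)%E
  (fun k => fine 'E_P[Z k]%E) (eps * eta) _ _ _ _ sumZ.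
rewrite card_ord; apply.
- exact: mulr_gt0.
- by move=> k; rewrite fine_ge0// expectation_ge0.
(* At a bad [k] the probability exceeds [eta], so Markov's inequality makes the expected deviation
   at least [eps * eta]. *)
move=> k; rewrite -ltNge => bad.
rewrite -lee_fin fineK ?expectation_fin_num//.
have mZ : measurable_fun setT (Z k).
  by have /Lfun1_integrable/measurable_int/measurable_EFinP := LZ k.
apply: le_trans (ge0_markov _ _ mZ (Z0 k) eps0).
by rewrite EFinM lee_wpmul2l ?lee_fin ?ltW.
Qed.
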